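(* Let $X$ be a non-trivial compact Hausdorff space and $\lambda$ an infinite cardinal with $\mathrm{cf}(w(X))>\lambda$. Then $$\{w(X),\mathrm{cf}(w(X))\}\subseteq\{\kappa:\kappa\text{ is an infinite cardinal and }\mathrm{cf}(\kappa)>\lambda\}\setminus\mathsf{C}(C_p(X^\lambda)).$$
   Context: A space is non-trivial if it has at least two points. The weight is $w(X)=\min\{|\mathcal{B}|:\mathcal{B}\text{ a base for }X\}+\omega$. For a Tychonoff space $Y$, $C_p(Y)$ is the set of continuous functions $Y\to\mathbb{R}$ with the topology of pointwise convergence (the subspace topology from $\mathbb{R}^Y$). An infinite cardinal $\kappa$ is a caliber for a space $Z$ if for every set $I$ with $|I|=\kappa$ and every indexed family $\{U_\alpha:\alpha\in I\}$ of nonempty open subsets of $Z$ there is $J\subseteq I$ with $|J|=\kappa$ and $\bigcap_{\alpha\in J}U_\alpha\neq\emptyset$. $\mathsf{C}(Z)$ denotes the class of all infinite cardinals that are calibers for $Z$. *)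

(* Defs.v *)
From HB Require Import structures.
From mathcomp Require Import all_boot all_order all_algebra.
From mathcomp Require Import wochoice all_classical reals topology normedtype.

Set Implicit Arguments.
Unset Strict Implicit.
Unset Printing Implicit Defensive.

Import numFieldNormedType.Exports.

Local Open Scope classical_set_scope.
Local Open Scope card_scope.

(** Cardinals are represented by types: the type [K] stands for the cardinal
    |K|, and equality and order of cardinals are equinumerosity and
    injectability, [[set: K] #= [set: K']] and [[set: K] #<= [set: K']]. *)

Definition infinite_card (K : Type) : Prop := infinite_set [set: K].

Definition card_lt (K K' : Type) : Prop :=
  [set: K] #<= [set: K'] /\ ~ ([set: K'] #<= [set: K]).

Definition min_card_of (T : Type) (P : set (set T)) (A : set T) : Prop :=
  P A /\ forall B, P B -> A #<= B.

(** A member of [P] of least cardinality ([set0] if [P] is empty). *)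
Definition min_card (T : Type) (P : set (set T)) : set T :=
  xget set0 (min_card_of P).

(** [R] is isomorphic to the order of the initial ordinal of cardinality |K|:
    a well-order of [K] all of whose proper initial segments are smaller. *)
Definition is_initial_order (K : Type) (R : rel K) : Prop :=
  well_order R /\
  forall x, ~ ([set: K] #<= [set y | R y x /\ y <> x]).

Definition initial_order (K : Type) : rel K :=
  xget (fun _ _ => true) (@is_initial_order K).

Definition cofinal (K : Type) (R : rel K) (A : set K) : Prop :=
  forall x, exists2 y, A y & R x y.

(** The cofinality of |K|: the least cardinality of a cofinal subset of its
    initial ordinal. *)
Definition cf (K : Type) : Type :=
  set_type (min_card (cofinal (@initial_order K))).

(** The sum type with [nat] is the cardinal sum with omega. *)
Definition weight (X : topologicalType) : Type :=
  (set_type (min_card (@basis X)) + nat)%type.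

Definition Cp (R : realType) (Y : topologicalType) : topologicalType :=
  set_type [set f : {ptws Y -> R} | continuous (f : Y -> R)].

Definition caliber (Z : topologicalType) (K : Type) : Prop :=
  infinite_card K /\
  forall (I : Type) (U : I -> set Z), [set: I] #= [set: K] ->
    (forall i, open (U i) /\ U i !=set0) ->
    exists J : set I, J #= [set: K] /\ \bigcap_(i in J) U i !=set0.

Lemma inj_card_le (T U : Type) (A : set T) (B : set U) (f : T -> U) :
  {in A &, injective f} -> (forall a, A a -> B (f a)) -> A #<= B.
Proof.
move=> finj fAB; apply: (@card_le_trans _ _ _ (f @` A)).
  by have := inj_card_eq finj; rewrite card_eq_le => /andP[].
by apply: subset_card_le => _ [a Aa <-]; exact: fAB.
Qed.

Lemma min_card_exists (T : Type) (P : set (set T)) :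
  P !=set0 -> exists A, min_card_of P A.
Proof.
move=> [P0 PP0].
(* sets of choice functions on which every evaluation is injective *)
pose ok (D : set (set T -> T)) :=
  (forall f, D f -> forall A, P A -> A (f A)) /\
  (forall f g, D f -> D g -> forall A, P A -> f A = g A -> f = g).
have [F Fok Ftot|D [[Dch Dinj] Dmax]] := @Zorn_bigcup _ ok.
  split=> [f [D FD Df]|f g [D FD Df] [E FE Eg]]; first by case: (Fok _ FD) => + _; exact.
  have [DE|ED] := Ftot _ _ FD FE; first by case: (Fok _ FE) => _; apply=> //; exact: DE.
  by case: (Fok _ FD) => _; apply=> //; exact: ED.
have [A PA surA] : exists2 A, P A & forall a, A a -> exists2 f, D f & f A = a.
  apply: contrapT => noA.
  have ex A : P A -> exists a, A a /\ forall f, D f -> f A <> a.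
    move=> PA; apply: contrapT => noa; apply: noA; exists A => // a Aa.
    apply: contrapT => nof; apply: noa; exists a; split=> // f Df fa.
    by apply: nof; exists f.
  have [a0 _] := ex _ PP0.
  have /choice[h hP] : forall A, exists a,
      P A -> A a /\ forall f, D f -> f A <> a.
    by move=> A; have [/ex[a aP]|nPA] := pselect (P A); [exists a|exists a0].
  apply: (Dmax (D `|` [set h])).
    split; first exact: subsetUl.
    move=> /(_ h (or_intror erefl)) Dh.
    by have [_ /(_ h Dh)] := hP _ PP0; apply.
  split=> [f [Df|->] B PB|f g [Df|->] [Dg|->] B PB fg //].
  - exact: (Dch f Df B PB).
  - by case: (hP _ PB).
  - exact: (Dinj _ _ Df Dg _ PB).
  - by case: (hP _ PB) => _ /(_ _ Df).
  - by case: (hP _ PB) => _ /(_ _ Dg); rewrite fg.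
exists A; split=> // B PB.
have /choice[g gP] : forall a, exists f, A a -> D f /\ f A = a.
  move=> a; have [/surA[f Df fa]|nAa] := pselect (A a); first by exists f.
  by exists (fun=> a).
apply: (@inj_card_le _ _ _ _ (fun a => g a B)) => [a b|a Aa]; last first.
  by have [Dga _] := gP _ Aa; exact: (Dch _ Dga B PB).
rewrite !inE => Aa Ab e.
have [Da Ea] := gP _ Aa; have [Db Eb] := gP _ Ab.
by rewrite -Ea -Eb (Dinj _ _ Da Db _ PB e).
Qed.

Lemma min_cardP (T : Type) (P : set (set T)) :
  P !=set0 -> min_card_of P (min_card P).
Proof. by move=> /min_card_exists[A]; exact: xgetI. Qed.

Lemma initial_orderP (K : Type) : is_initial_order (@initial_order K).
Proof.
suff [R] : exists R : rel K, is_initial_order R by exact: xgetI.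
have [R Rwo] : exists R : rel K, well_order R.
  by have [R] := well_ordering_principle {classic K}; exists R.
pose seg (S : rel K) x := [set y | S y x /\ y <> x].
have [small|] := pselect (forall x, ~ ([set: K] #<= seg R x)); first by exists R.
move=> /existsNP[x0 /contrapT x0big].
pose big : {pred K} := fun x => `[< [set: K] #<= seg R x >].
have /Rwo[x [[bigx minx] _]] : nonempty big by exists x0; exact/asboolP.
have [f finj fseg] : exists2 f : K -> K, injective f & forall y, seg R x (f y).
  move/asboolP: bigx => /card_leP[f].
  exists (fun y => set_val (f (SigSub (mem_setT y)))) => [y z /val_inj e|y].
    by have := 'inj_f (mem_setT _) (mem_setT _) e => /(congr1 val).
  exact: set_valP.
have Ranti : antisymmetric R.
  have Rxx y : R y y.
    have [|z [[/asboolP-> minz] _]] := Rwo (fun z => `[< z = y >]).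
      by exists y; exact/asboolP.
    by apply: minz; exact/asboolP.
  move=> a b /andP[Rab Rba].
  have [|z [_ zuniq]] := Rwo (fun z => `[< z = a \/ z = b >]).
    by exists a; apply/asboolP; left.
  rewrite -(zuniq a) ?(zuniq b) //; split; try by apply/asboolP; auto.
    by move=> _ /asboolP[]->.
  by move=> _ /asboolP[]->.
exists (fun a b => R (f a) (f b)); split.
  move=> A [a Aa].
  pose B : {pred K} := fun b => `[< exists2 a, a \in A & f a = b >].
  have /Rwo[b [[/asboolP[c Ac fcb] minb] _]] : nonempty B.
    by exists (f a); apply/asboolP; exists a.
  exists c; split.
    split=> // d Ad; rewrite fcb; apply: minb; apply/asboolP; by exists d.
  move=> d [Ad mind]; apply: finj; apply: Ranti.
  rewrite mind // andbT fcb; apply: minb; apply/asboolP; by exists d.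
move=> a big_a; have [faR fax] := fseg a.
have /minx : f a \in big.
  apply/asboolP; apply: (card_le_trans big_a).
  apply: (@inj_card_le _ _ _ _ f) => [y z _ _|y [Rya ya]]; first exact: finj.
  by split=> // /finj.
by move=> Rxfa; apply: fax; apply: Ranti; rewrite faR Rxfa.
Qed.

(* Main.v *)
Require Import Defs.
From HB Require Import structures.
From mathcomp Require Import all_boot all_order all_algebra.
From mathcomp Require Import wochoice all_classical reals topology normedtype.
From mathcomp Require Import lra.

(** Let [W] be the weight of [X], well-ordered as an initial ordinal, with a
    base of [X] of least cardinality indexed by [W].  For [w] in [W], the base
    members of index below [w] cannot separate the points of [X] by disjoint
    pairs: in a compact space the finite intersections of a separating family
    of open sets form a base, and this base would be too small
    ([weight_segment_not_separating]).  So each [w] comes with two distinct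
    points [x_w], [y_w] that the members of index below [w] do not separate.

    A continuous [f] on [X] sees only finitely many base members: finitely many
    of them, each with small oscillation of [f], cover [X], and whenever
    [f x > f y + 1] the members around [x] and [y] are disjoint
    ([finite_oscillation_cover]).  So [f x_w > f y_w + 1] can hold only for [w]
    in a bounded part of [W].

    Given [g : K -> W], let [U_k] be the set of the functions on the power
    [X^L] that decrease by more than [1] from the constant point [x_(g k)] to
    the constant point [y_(g k)].  These are nonempty open subsets of
    [C_p(X^L)], and if a subfamily has a common point, then restricting that
    point to the diagonal shows that [g] is bounded on the subfamily.  If every
    bounded part of [W] has fewer than [|K|] preimages by [g], then [K] is not a
    caliber ([not_caliber_Cp]).  For [|K| = |W|] a bijection [g] will do; for
    [|K| = cf |W|] it is an increasing cofinal sequence ([cf_strict_bounds]).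

    The number of finite intersections is controlled by Hessenberg's theorem
    [|T x T| = |T|] ([infinite_pairing]).  It gives a base of fewer than [|W|]
    sets because [W] is uncountable, which is what [cf |W| > |L| >= omega]
    yields.  Finally [cf K] exceeds [L] because cofinality depends only on the
    cardinality, initial orders being unique up to isomorphism
    ([initial_order_iso]), and because [cf (cf W) = cf W] ([cf_cf]). *)

Set Implicit Arguments.
Unset Strict Implicit.
Unset Printing Implicit Defensive.

Import Order.TTheory GRing.Theory Num.Theory.
Import numFieldNormedType.Exports.

Local Open Scope classical_set_scope.
Local Open Scope card_scope.

(** * Cardinal arithmetic *)

(** With a default value in [U], an injection between two sets becomes a total
    function, which is what the constructions below compose. *)
Lemma card_le_fun (T U : Type) (A : set T) (B : set U) (u0 : U) : A #<= B ->
  exists f : T -> U, {in A &, injective f} /\ forall a, A a -> B (f a).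
Proof.
move=> /card_leP[f].
pose g a := if pselect (A a) is left Aa then val (f (SigSub (mem_set Aa)))
            else u0.
exists g; split=> [a b|a Aa]; rewrite /g.
  rewrite !inE; do 2!case: pselect => // ?; move=> _ _ /val_inj e.
  by have /(congr1 val) := 'inj_f (mem_set I) (mem_set I) e.
by case: pselect => // Aa'; exact: set_valP.
Qed.

Lemma card_leTP (T U : Type) :
  [set: T] #<= [set: U] <-> exists f : T -> U, injective f.
Proof.
split=> [|[f finj]]; last by apply: (@Defs.inj_card_le _ _ _ _ f) => // ? ? _ _ /finj.
have [[t]|noT _] := pselect (inhabited T); last first.
  have e (t : T) : False by apply: noT.
  by exists (fun t => False_rect U (e t)) => t; have := e t.
move=> TU; have [u] : inhabited U.
  case/card_leP: TU => f.
  exact: (inhabits (val (f (SigSub (mem_set (I : [set: T] t)))))).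
have [f [finj _]] := card_le_fun u TU.
by exists f => a b; apply: finj; rewrite inE.
Qed.

(** Comparability of cardinals: a pair of sets has a member of least
    cardinality. *)
Lemma card_le_total (T : Type) (A B : set T) : A #<= B \/ B #<= A.
Proof.
have [|C [[->|->] Cmin]] := @min_card_exists _ [set C | C = A \/ C = B].
- by exists A; left.
- by left; apply: Cmin; right.
- by right; apply: Cmin; left.
Qed.

Lemma left_inverse_on (T U : Type) (A : set T) (t0 : T) (f : T -> U) :
  {in A &, injective f} -> exists r, forall a, A a -> r (f a) = a.
Proof.
move=> finj.
have /choice[r rP] : forall u, exists a, forall a', A a' -> f a' = u -> a' = a.
  move=> u; have [[a [Aa fa]]|no] := pselect (exists a, A a /\ f a = u).
    by exists a => a' Aa' fa'; apply: finj; rewrite ?inE// fa.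
  by exists t0 => a' Aa' fa'; case: no; exists a'.
by exists r => a Aa; rewrite -(rP _ _ Aa erefl).
Qed.

Section Pairing.
Variable T : Type.

(** The pair [(D, p)] stands for the restriction of [p] to the square of [D].
    The two distinct points of [D] serve as tags that tell apart two copies of
    [D]. *)
Definition pairing_on (q : set T * (T * T -> T)) : Prop :=
  [/\ exists a b, [/\ q.1 a, q.1 b & a <> b],
      forall x y, q.1 x -> q.1 y -> q.1 (q.2 (x, y)) &
      forall x y x' y', q.1 x -> q.1 y -> q.1 x' -> q.1 y' ->
        q.2 (x, y) = q.2 (x', y') -> x = x' /\ y = y'].

Definition pairing_ext (q r : set T * (T * T -> T)) : Prop :=
  q.1 `<=` r.1 /\ forall x y, q.1 x -> q.1 y -> q.2 (x, y) = r.2 (x, y).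

Lemma countable_pairing : infinite_set [set: T] -> exists q, pairing_on q.
Proof.
move=> /infiniteP /card_leTP[e einj].
have [|r rK] := @left_inverse_on _ _ [set: nat] 0%N e; first by move=> ? ? _ _; exact: einj.
have /card_leTP[c cinj] : [set: nat * nat] #<= [set: nat].
  by have := card_nat2; rewrite card_eq_le => /andP[].
exists (range e, fun z => e (c (r z.1, r z.2))); split => /=.
- by exists (e 0%N), (e 1%N); split; [exists 0%N|exists 1%N|move/einj].
- by move=> x y _ _; exists (c (r x, r y)).
- move=> _ _ _ _ [m _ <-] [n _ <-] [m' _ <-] [n' _ <-].
  by rewrite !rK// => /einj /cinj[-> ->].
Qed.

(** The union of a chain of partial pairings is again one, as any two points of
    the union already lie in the domain of a single member. *)
Lemma chain_pairing (F : set (set T * (T * T -> T))) (q0 : set T * (T * T -> T)) :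
  F q0 -> F `<=` pairing_on ->
  (forall q r, F q -> F r -> pairing_ext q r \/ pairing_ext r q) ->
  exists r, pairing_on r /\ forall q, F q -> pairing_ext q r.
Proof.
move=> Fq0 Fok Ftot.
have /choice[p pP] : forall z : T * T, exists v, forall q, F q ->
    q.1 z.1 -> q.1 z.2 -> q.2 z = v.
  move=> [x y] /=; have [[q [Fq qx qy]]|no] :=
      pselect (exists q, [/\ F q, q.1 x & q.1 y]).
    exists (q.2 (x, y)) => r Fr rx ry.
    by have [[_ ->]|[_ ->]] := Ftot _ _ Fq Fr.
  by exists x => q Fq qx qy; case: no; exists q.
pose D := \bigcup_(q in F) q.1.
have common x y : D x -> D y -> exists q, [/\ F q, q.1 x & q.1 y].
  move=> [q Fq qx] [r Fr ry].
  have [[qr _]|[rq _]] := Ftot _ _ Fq Fr.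
    by exists r; split=> //; exact: qr.
  by exists q; split=> //; exact: rq.
exists (D, p); split; last first.
  move=> q Fq; split=> /= [x qx|x y qx qy]; first by exists q.
  exact: (pP (x, y)).
split=> /=.
- have [[a [b [qa qb ab]]] _ _] := Fok _ Fq0.
  by exists a, b; split=> //; exists q0.
- move=> x y Dx Dy; have [q [Fq qx qy]] := common _ _ Dx Dy.
  rewrite -(pP (x, y) q)//; have [_ + _] := Fok _ Fq.
  by move=> /(_ _ _ qx qy) ?; exists q.
- move=> x y x' y' Dx Dy Dx' Dy'.
  have [q [Fq qx qy]] := common _ _ Dx Dy.
  have [r [Fr rx ry]] := common _ _ Dx' Dy'.
  rewrite -(pP (x, y) q)// -(pP (x', y') r)//.
  have [_ _ qinj] := Fok _ Fq; have [_ _ rinj] := Fok _ Fr.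
  have [[qr qrE]|[rq rqE]] := Ftot _ _ Fq Fr.
    by rewrite qrE//; apply: rinj => //; exact: qr.
  by rewrite rqE//; apply: qinj => //; exact: rq.
Qed.

(** With a copy [E] of [D] outside of [D], the pairs of points of [D] and [E]
    that are not yet paired can be coded injectively by points of [D], using
    [p] and tags, and then moved into the copy [E], where they do not clash with
    the old values. *)
Lemma extend_pairing (q : set T * (T * T -> T)) :
  pairing_on q -> q.1 #<= ~` q.1 ->
  exists r, [/\ pairing_on r, pairing_ext q r & ~ r.1 `<=` q.1].
Proof.
case: q => D p [[a [b [/= Da Db ab]]] /= pD pinj] DC.
have [e [einj eC]] := card_le_fun a DC.
have [r rK] := left_inverse_on a einj.
(* a point of the union of [D] and its copy is known from its tag, telling on
   which side it lies, and from its representative [bar x] in [D] *)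
pose tag x := if `[< D x >] then a else b.
pose bar x := if `[< D x >] then x else r x.
pose E := D `|` e @` D.
have tagD x : D (tag x) by rewrite /tag; case: ifP.
have barD x : E x -> D (bar x).
  move=> [Dx|[d Dd <-]]; rewrite /bar; first by rewrite asboolT.
  by rewrite asboolF ?rK//; exact: eC.
have key x y : E x -> E y -> tag x = tag y -> bar x = bar y -> x = y.
  have nD d : D d -> `[< D (e d) >] = false by move=> Dd; rewrite asboolF//; exact: eC.
  move=> [Dx|[d Dd <-]] [Dy|[d' Dd' <-]]; rewrite /tag /bar ?nD ?(asboolT Dx) ?(asboolT Dy)//.
    by move/esym.
  by rewrite !rK// => _ ->.
have Dt u v : D (p (tag u, tag v)) by exact: pD.
have Db' u v : E u -> E v -> D (p (bar u, bar v)) by move=> ? ?; apply: pD; exact: barD.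
have Dv u v : E u -> E v -> D (p (p (tag u, tag v), p (bar u, bar v))).
  by move=> Eu Ev; apply: pD; [exact: Dt|exact: Db'].
pose p' z := if `[< D z.1 /\ D z.2 >] then p z
             else e (p (p (tag z.1, tag z.2), p (bar z.1, bar z.2))).
exists (E, p'); split; last first.
- by move=> /(_ (e a)) /= H; apply: (eC _ Da); apply: H; right; exists a.
- split=> /= [x Dx|x y Dx Dy]; first by left.
  by rewrite /p' asboolT.
split=> /=.
- by exists a, b; split=> //; left.
- move=> x y Ex Ey; rewrite /p' /=; case: asboolP => [[Dx Dy]|_].
    by left; exact: pD.
  by right; exists (p (p (tag x, tag y), p (bar x, bar y))) => //; exact: Dv.
- move=> x y x' y' Ex Ey Ex' Ey'; rewrite /p' /=.
  case: asboolP => [[Dx Dy]|_]; case: asboolP => [[Dx' Dy']|_].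
  + exact: pinj.
  + by move=> eq; case: (eC _ (Dv _ _ Ex' Ey')); rewrite -eq; exact: pD.
  + by move=> eq; case: (eC _ (Dv _ _ Ex Ey)); rewrite eq; exact: pD.
  + move=> /(einj _ _ (mem_set (Dv _ _ Ex Ey)) (mem_set (Dv _ _ Ex' Ey'))).
    move=> /pinj[]; do ?[exact: Dt|exact: Db'].
    move=> /pinj[]// tx ty /pinj[]; do ?[exact: barD].
    by move=> bx by_; split; exact: key.
Qed.

(** Hessenberg's theorem.  A maximal partial pairing lives on a set [D] that is
    not dominated by its complement, so [T] splits into two sets that inject
    into [D], and the pairing of [D] transfers to [T]. *)
Theorem infinite_pairing : infinite_set [set: T] ->
  exists p : T * T -> T, injective p.
Proof.
move=> /countable_pairing[q0 q0P].
pose S := {q : set T * (T * T -> T) | pairing_on q}.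
have [| | |[q qP] qmax] := @ZL_preorder S (exist _ q0 q0P)
    (fun q r => `[< pairing_ext (sval q) (sval r) >]).
- by move=> q; apply/asboolP; split.
- move=> q r s /asboolP[qr qrE] /asboolP[rs rsE]; apply/asboolP; split.
    exact: subset_trans rs.
  by move=> x y qx qy; rewrite qrE// rsE//; exact: qr.
- move=> A Atot; have [[q1 Aq1]|A0] := pselect (exists q, A q); last first.
    by exists (exist _ q0 q0P) => q Aq; case: A0; exists q.
  have [|q [s As <-]|_ _ [s As <-] [t At <-]|r [rP ub]] :=
      @chain_pairing (sval @` A) (sval q1); first by exists q1.
  + exact: svalP.
  + by have [/asboolP|/asboolP] := Atot _ _ As At; [left|right].
  + by exists (exist _ r rP) => s As; apply/asboolP/ub; exists s.
have noext r : pairing_on r -> pairing_ext q r -> r.1 `<=` q.1.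
  by move=> rP /asboolP/(qmax (exist _ r rP))/asboolP[].
have [DC|] := card_le_total q.1 (~` q.1).
  by have [r [rP qr []]] := extend_pairing qP DC; exact: noext.
case: q qP {qmax noext} => D p [[a [b [/= Da Db ab]]] /= pD pinj] CD.
have [f [finj fD]] := card_le_fun a CD.
pose h x := if `[< D x >] then p (a, x) else p (b, f x).
have hD x : D (h x) by rewrite /h; case: asboolP => Dx; apply: pD => //; exact: fD.
have hinj : injective h.
  move=> x y; rewrite /h; case: asboolP => Dx; case: asboolP => Dy.
  - by move=> /pinj[].
  - by move=> /pinj[]//; exact: fD.
  - by move=> /pinj[]//; [exact: fD|move=> /esym].
  - move=> /pinj[]//; try exact: fD.
    by move=> _; apply: finj; rewrite inE.
exists (fun z => p (h z.1, h z.2)) => -[x y] [x' y'] /= /pinj[]//.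
by move=> /hinj-> /hinj->.
Qed.

End Pairing.

(** Iterating a pairing codes the sequences of a given size, and pairing the
    result with the size codes all of them. *)
Lemma card_le_seq (T : Type) : infinite_set [set: T] ->
  [set: seq T] #<= [set: T].
Proof.
move=> Tinf; have [p pinj] := infinite_pairing Tinf.
have /infiniteP/card_leTP[e einj] := Tinf.
pose code := foldr (fun x c => p (x, c)) (e 0%N).
apply/card_leTP; exists (fun s => p (e (size s), code s)) => s t /pinj[/einj].
elim: s t => [|x s IHs] [|y t]//= [/IHs{}IHs] /pinj[-> /IHs]; by move->.
Qed.

(** The points are coded by sequences of size one, the integers by longer
    constant sequences. *)
Lemma card_le_sum_nat (T : Type) : infinite_set [set: T] ->
  [set: T + nat] #<= [set: T].
Proof.
move=> Tinf; apply: card_le_trans (card_le_seq Tinf).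
have /infiniteP/card_leTP[e _] := Tinf.
apply/card_leTP; exists (fun u => match u with
  | inl x => [:: x] | inr n => nseq n.+2 (e 0%N) end).
move=> [x|m] [y|n] //= [].
  by move=> ->.
by move=> /(congr1 size); rewrite !size_nseq => ->.
Qed.

(** * Initial orders and cofinality *)

Section WellOrder.
Variables (K : Type) (R : rel K).
Hypothesis Rwo : well_order R.

Let Rchain : @wo_chain {classic K} R predT.
Proof. by move=> A _; exact: Rwo. Qed.

Lemma wo_refl x : R x x.
Proof. exact: (wo_chain_reflexive Rchain). Qed.

Lemma wo_anti x y : R x y -> R y x -> x = y.
Proof.
by move=> xy yx; apply: (wo_chain_antisymmetric Rchain); rewrite // xy yx.
Qed.

Lemma wo_total x y : R x y \/ R y x.
Proof. by apply/orP; exact: (wo_chainW Rchain). Qed.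

Lemma wo_least (A : set K) : A !=set0 ->
  exists x, A x /\ forall y, A y -> R x y.
Proof.
move=> [a Aa]; have [|x [[/asboolP Ax xmin] _]] := Rwo (A := fun x => `[< A x >]).
  by exists a; exact/asboolP.
by exists x; split=> // y Ay; apply: xmin; exact/asboolP.
Qed.

Lemma wo_trans y x z : R x y -> R y z -> R x z.
Proof.
move=> xy yz; have [|m [[->|[->|->]] mmin]] :=
    @wo_least [set t | t = x \/ t = y \/ t = z]; first by exists x; left.
- by apply: mmin; right; right.
- by rewrite (wo_anti xy (mmin x _))//; left.
- by rewrite -(wo_anti yz (mmin y _))//; right; left.
Qed.

Lemma wo_lt_le x y z : R x y /\ x <> y -> R y z -> R x z /\ x <> z.
Proof.
move=> [xy nxy] yz; split; first exact: wo_trans yz.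
by move=> xz; apply: nxy; apply: wo_anti => //; rewrite xz.
Qed.

Lemma wo_le_lt x y z : R x y -> R y z /\ y <> z -> R x z /\ x <> z.
Proof.
move=> xy [yz nyz]; split; first exact: wo_trans yz.
by move=> xz; apply: nyz; apply: wo_anti => //; rewrite -xz.
Qed.

Lemma wo_not_lt x y : ~ (R x y /\ x <> y) <-> R y x.
Proof.
split=> [nxy|yx [xy]]; last by apply; exact: wo_anti.
have [xy|//] := wo_total x y.
by have [->|nE] := pselect (x = y); [exact: wo_refl|case: nxy].
Qed.

Lemma wo_wf : well_founded (fun x y => R x y /\ x <> y).
Proof.
move=> x; apply: contrapT => nx.
have [|m [nm mmin]] := @wo_least [set x | ~ Acc (fun x y => R x y /\ x <> y) x].
  by exists x.
apply: nm; constructor => y ym; apply: contrapT => ny.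
by have /wo_not_lt := mmin _ ny.
Qed.

Lemma wo_finite_bound (T : eqType) (P : T -> K -> Prop) (k0 : K) (s : seq T) :
  (forall t, t \in s -> exists k, P t k) ->
  exists b, forall t, t \in s -> exists2 k, P t k & R k b.
Proof.
elim: s => [_|t s IHs sP]; first by exists k0.
have [|b bP] := IHs; first by move=> u us; apply: sP; rewrite inE us orbT.
have [k Ptk] := sP t (mem_head _ _).
have [kb|bk] := wo_total k b.
  by exists b => u; rewrite inE => /predU1P[->|/bP//]; exists k.
exists k => u; rewrite inE => /predU1P[->|/bP[k' Pk' k'b]].
  by exists k => //; exact: wo_refl.
by exists k' => //; exact: wo_trans bk.
Qed.

End WellOrder.

Definition initial_order_wo K : well_order (@initial_order K) :=
  (initial_orderP K).1.
Arguments initial_order_wo : clear implicits.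

(** By definition the strict initial segments are small.  For an infinite type
    so are the closed ones: if [K] embeds into a closed segment then so does [K]
    with an extra point, and the image of the extra point can be used instead of
    the value [x], giving an embedding into the strict segment. *)
Lemma infinite_not_le_segment (K : Type) (x : K) : infinite_set [set: K] ->
  ~ ([set: K] #<= [set y | initial_order y x]).
Proof.
move=> Kinf KS; apply: (initial_orderP K).2 (x) _.
have := card_le_trans (card_le_sum_nat Kinf) KS.
move=> /(card_le_fun x)[g [ginj gS]].
have {}ginj : injective g by move=> u v; apply: ginj; rewrite inE.
pose h k := if pselect (g (inl k) = x) then g (inr 0%N) else g (inl k).
apply: (@Defs.inj_card_le _ _ _ _ h) => [k k' _ _|k _]; rewrite /h.
  case: (pselect (g (inl k) = x)) => [e|n]; case: (pselect (g (inl k') = x)) => [e'|n'].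
  - by move=> _; have /ginj[] := etrans e (esym e').
  - by move=> /ginj.
  - by move=> /ginj.
  - by move=> /ginj[].
case: pselect => [e|n] /=; split=> //; try exact: gS.
by rewrite -e => /ginj.
Qed.

Lemma cfP (K : Type) : min_card_of (cofinal (@initial_order K))
  (min_card (cofinal (@initial_order K))).
Proof.
by apply: min_cardP; exists setT => x; exists x => //; exact: wo_refl (initial_order_wo K) _.
Qed.

Lemma cf_le (K : Type) (T : Type) (f : T -> K) :
  (forall x, exists t, initial_order x (f t)) -> [set: cf K] #<= [set: T].
Proof.
move=> fcof; rewrite (card_le_eql (card_setT _)).
apply: card_le_trans (card_image_le f _); apply: (cfP K).2.
by move=> x; have [t xt] := fcof x; exists (f t) => //; exists t.
Qed.

Lemma cf_le_self (K : Type) : [set: cf K] #<= [set: K].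
Proof.
by apply: (cf_le (f := id)) => x; exists x; exact: wo_refl (initial_order_wo K) _.
Qed.

(** Send each [k], by recursion, to the least point not yet reached.  There is
    such a point because the segment below [k] is too small to exhaust [K'], and
    every point is reached because [K] is too large to be embedded into a
    segment of [K']. *)
Lemma initial_order_iso (K K' : Type) : [set: K] #= [set: K'] ->
  exists phi : K -> K',
    (forall j k, initial_order j k -> initial_order (phi j) (phi k)) /\
    forall w, exists k, phi k = w.
Proof.
rewrite card_eq_le => /andP[KK' K'K].
have [[w0]|noK'] := pselect (inhabited K'); last first.
  have /card_leTP[f _] := KK'.
  have e (k : K) : False by apply: noK'; exact: (inhabits (f k)).
  exists f; split=> [j|w]; first by case: (e j).
  by case: noK'; exact: (inhabits w).
pose lt j k := @initial_order K j k /\ j <> k.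
have wo := initial_order_wo K; have wo' := initial_order_wo K'.
pose body k (rec : forall j, lt j k -> K') : K' :=
  @xget {classic K'} w0 [set w | (forall j (h : lt j k), rec j h <> w) /\
    forall v, (forall j (h : lt j k), rec j h <> v) -> initial_order w v].
pose phi := Fix (wo_wf wo) _ body.
have phiE k : phi k = body k (fun j _ => phi j).
  rewrite /phi Fix_eq// => x f g fg; congr body.
  by apply: functional_extensionality_dep => j; exact: functional_extensionality_dep.
have phiP k : (forall j, lt j k -> phi j <> phi k) /\
    forall v, (forall j, lt j k -> phi j <> v) -> initial_order (phi k) v.
  have [|w [nw wmin]] := @wo_least _ _ wo' [set w | forall j, lt j k -> phi j <> w].
    apply: contrapT => none; apply: (initial_orderP K).2 (k) _.
    apply: card_le_trans KK' _.
    apply: (@card_le_trans _ _ _ (phi @` [set j | lt j k])); last exact: card_image_le.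
    apply: subset_card_le => w _; apply: contrapT => nw; apply: none.
    by exists w => j jk jw; apply: nw; exists j.
  have ex : exists w, (forall j, lt j k -> phi j <> w) /\
      forall v, (forall j, lt j k -> phi j <> v) -> initial_order w v.
    by exists w; split=> // v nv; exact: wmin.
  by have := @xgetPex {classic K'} w0 _ ex; rewrite (phiE k).
exists phi; split=> [j k jk|w].
  have [->|njk] := pselect (j = k); first exact: wo_refl.
  apply: (phiP j).2 => i ij; apply: (phiP k).1.
  exact: (wo_lt_le wo ij).
have phiinj : injective phi.
  move=> j k; have [jk|kj] := wo_total wo j k => e; apply: contrapT => n.
    exact: ((phiP k).1 j).
  by apply: ((phiP j).1 k) => //; split=> // /esym.
apply: contrapT => nw; apply: (initial_orderP K').2 (w) _.
apply: card_le_trans K'K _; apply: (@Defs.inj_card_le _ _ _ _ phi) => [? ? _ _|k _].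
  exact: phiinj.
split; last by move=> e; apply: nw; exists k.
by apply: (phiP k).2 => j _ e; apply: nw; exists j.
Qed.

Lemma cf_card_eq (K K' : Type) : [set: K] #= [set: K'] ->
  [set: cf K'] #<= [set: cf K].
Proof.
move=> /initial_order_iso[phi [phimono phisurj]].
apply: (cf_le (f := phi \o set_val)) => w.
have [k <-] := phisurj w; have [c Cc kc] := (cfP K).1 k.
by exists (SigSub (mem_set Cc)); exact: phimono.
Qed.

(** The cofinal set of least cardinality need not have the order type of its
    cardinal, so a cofinal map on [cf K] that is compatible with the initial
    order of [cf K] has to be constructed: a closed segment of [cf K] has fewer
    elements than the cofinality, hence it is not cofinal in [K]. *)
Lemma cf_strict_bounds (K : Type) : infinite_set [set: cf K] ->
  exists g : cf K -> K, forall i j : cf K, initial_order j i ->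
    initial_order (set_val j) (g i) /\ set_val j <> g i.
Proof.
move=> Cinf; have wo := initial_order_wo K.
suff above : forall i : cf K, exists x, forall j : cf K, initial_order j i ->
    @initial_order K (set_val j) x /\ set_val j <> x.
  by have [g gP] := choice above; exists g.
move=> i; apply: contrapT => nox.
apply: (infinite_not_le_segment (x := i) Cinf).
rewrite (card_le_eql (card_setT _)).
apply: card_le_trans (card_image_le set_val _); apply: (cfP K).2 => x.
apply: contrapT => nx; apply: nox; exists x => j ji.
apply: contrapT => /(wo_not_lt wo) xj; apply: nx.
by exists (set_val j) => //; exists j.
Qed.

(** A cofinal set of [cf K] gives one of [K] through the map of
    [cf_strict_bounds]. *)
Lemma cf_cf (K : Type) : infinite_set [set: cf K] ->
  [set: cf K] #<= [set: cf (cf K)].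
Proof.
move=> /cf_strict_bounds[g gP].
apply: (cf_le (f := g \o set_val)) => x.
have wo := initial_order_wo K.
have [c Cc xc] := (cfP K).1 x.
have [d Dd cd] := (cfP (cf K)).1 (SigSub (mem_set Cc)).
exists (SigSub (mem_set Dd)); apply: (wo_trans wo xc).
exact: (gP _ _ cd).1.
Qed.

(** * Bases and separation of points *)

Definition separates (X : Type) (A : set (set X)) (x y : X) : Prop :=
  exists U V, [/\ A U, A V, U x, V y & U `&` V = set0].

Definition finite_inter (X : Type) (A : set (set X)) (s : seq A) : set X :=
  foldr (fun U acc => set_val U `&` acc) setT s.

Lemma finite_inter_mem (X : Type) (A : set (set X)) (s : seq A) (x : X) :
  finite_inter s x <-> forall U, U \in s -> set_val U x.
Proof.
elim: s => [|U s IHs] /=; first by split.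
split=> [[Ux /IHs sx] V|sx]; first by rewrite inE => /predU1P[->|/sx].
split; first exact/sx/mem_head.
by apply/IHs => V Vs; apply: sx; rewrite inE Vs orbT.
Qed.


Lemma seq_choice (T U : eqType) (P : T -> U -> Prop) (s : seq T) :
  (forall t, t \in s -> exists u, P t u) ->
  exists r : seq U, (forall t, t \in s -> exists2 u, u \in r & P t u) /\
    forall u, u \in r -> exists2 t, t \in s & P t u.
Proof.
elim: s => [_|t s IHs sP]; first by exists [::].
have [|r [rs sr]] := IHs; first by move=> v vs; apply: sP; rewrite inE vs orbT.
have [u Ptu] := sP t (mem_head _ _).
exists (u :: r); split=> [v|v]; rewrite inE => /predU1P[->|].
- by exists u => //; exact: mem_head.
- by move=> /rs[w wr Pw]; exists w => //; rewrite inE wr orbT.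
- by exists t => //; exact: mem_head.
- by move=> /sr[w ws Pw]; exists w => //; rewrite inE ws orbT.
Qed.

(** Compactness in terms of covers, for a space without a distinguished point. *)
Lemma compact_finite_subcover (X : topologicalType) (A : set X)
    (D : set (set X)) :
  compact A -> D `<=` open -> (forall x, A x -> exists2 U, D U & U x) ->
  exists s : seq (set X), (forall U, U \in s -> D U) /\
    forall x, A x -> exists2 U, U \in s & U x.
Proof.
move=> Aco Dop Dcov; have [->|/set0P[x0 _]] := eqVneq A set0.
  by exists [::].
pose P : ptopologicalType := HB.pack (Topological.sort X) (isPointed.Build X x0).
have : @cover_compact P A by rewrite -compact_cover.
move=> /(_ _ D id)[|x /Dcov[]|F FD Fcov].
- by move=> U DU; exact: (Dop U DU).
- by move=> U; exists U.
- exists (finmap.enum_fset F); split=> [U /FD|x /Fcov[U UF Ux]]; first by rewrite inE.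
  by exists U.
Qed.

(** The topology generated by a separating family is Hausdorff and coarser than
    the given compact one, so the two coincide.  Concretely, the complement of a
    neighbourhood of [x] is covered by finitely many members of [A], each
    disjoint from a member of [A] around [x]. *)
Lemma separating_basis (X : topologicalType) (A : set (set X)) :
  compact [set: X] -> A `<=` open ->
  (forall x y, x <> y -> separates A x y) -> basis (range (@finite_inter X A)).
Proof.
move=> Xco Aop Asep; split=> [_ [s _ <-]|x O].
  elim: s => [|U s IHs] /=; first exact: openT.
  by apply: openI => //; exact/Aop/set_valP.
rewrite nbhsE => -[O' [O'op O'x] O'O].
pose D := [set V | A V /\ exists U : A, set_val U x /\ set_val U `&` V = set0].
have : compact (~` O') by apply: subclosed_compact Xco _ => //; exact: open_closedC.
move=> /compact_finite_subcover-/(_ D)[V [/Aop//]|y nO'y|F [FD Fcov]].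
  have [|U [V [AU AV Ux Vy UV]]] := Asep x y; first by move=> e; rewrite -e in nO'y.
  by exists V => //; split=> //; exists (SigSub (mem_set AU)).
have [V VF|r [rF Fr]] := @seq_choice _ _
    (fun (V : set X) (U : A) => set_val U x /\ set_val U `&` V = set0) F.
  by have [_] := FD _ VF.
exists (finite_inter r); first split; first by exists r.
  by apply/finite_inter_mem => U /Fr[V _ []].
move=> y /finite_inter_mem ry; apply: O'O; apply: contrapT => /Fcov[V VF Vy].
have [U Ur [_ UV]] := rF V VF.
suff : (set_val U `&` V) y by rewrite UV.
by split=> //; exact: ry.
Qed.

(** Base sets on which [f] varies by less than [1/2] cover [X]; if two sets of a
    finite subcover meet, then [f] varies by less than [1] on their union. *)
Lemma finite_oscillation_cover (R : realType) (X : topologicalType)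
    (B : set (set X)) (f : X -> R) :
  compact [set: X] -> basis B -> continuous f ->
  exists s : seq (set X), (forall U, U \in s -> B U) /\
    forall x y, (f y + 1 < f x)%R -> separates [set U | U \in s] x y.
Proof.
move=> Xco [Bop Bnbhs] fcont.
pose D := [set U | B U /\ forall x y, U x -> U y -> (f x - f y < 1 / 2)%R].
have [V [/Bop//]|x _|F [FD Fcov]] := compact_finite_subcover (D := D) Xco.
  have /fcont /= : nbhs (f x) (ball (f x) (1 / 4)%R) by apply: nbhsx_ballx; lra.
  move=> /Bnbhs[U [BU Ux] Uball]; exists U => //; split=> // y z Uy Uz.
  have := Uball _ Uy; have := Uball _ Uz.
  by rewrite /ball /= !ltr_distlC => /andP[? ?] /andP[? ?]; lra.
exists F; split=> [U /FD[]//|x y fxy].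
have [U UF Ux] := Fcov x I; have [V VF Vy] := Fcov y I.
exists U, V; split=> //; rewrite predeqE => z; split=> // -[Uz Vz].
have := (FD _ UF).2 _ _ Ux Uz; have := (FD _ VF).2 _ _ Vz Vy.
by move=> ? ?; exfalso; lra.
Qed.

Lemma min_card_basisP (X : topologicalType) :
  min_card_of (@basis X) (min_card (@basis X)).
Proof.
apply: min_cardP; exists open; split=> // x O.
by rewrite nbhsE => -[O' [O'op O'x] O'O]; exists O'.
Qed.

(** Otherwise the finite intersections of the base members of index below [w]
    would form a base: a countable one if these members are finite in number,
    and otherwise one with at most as many elements as the segment below [w]. *)
Lemma weight_segment_not_separating (X : topologicalType) (w : weight X) :
  let B := min_card (@basis X) in
  compact [set: X] -> ~ ([set: weight X] #<= [set: nat]) ->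
  exists x y, x <> y /\ ~ separates
    [set U | exists b : B, set_val b = U /\
       (initial_order (inl b : weight X) w /\ inl b <> w)] x y.
Proof.
move=> B Xco unc; set A := [set U | _].
have Bmin : min_card_of (@basis X) B := min_card_basisP X.
apply: contrapT => sep.
have Abasis : basis (range (@finite_inter X A)).
  apply: separating_basis => // [U [b [<- _]]|x y nxy].
    exact/Bmin.1.1/set_valP.
  by apply: contrapT => nsep; apply: sep; exists x, y.
have BA : [set: B] #<= [set: seq A].
  rewrite (card_le_eql (card_setT _)); apply: card_le_trans (Bmin.2 _ Abasis) _.
  exact: card_image_le.
have Aseg : [set: A] #<= [set u | initial_order u w /\ u <> w].
  have /choice[h hP] : forall U : A, exists b : B, set_val b = set_val U /\
      (initial_order (inl b : weight X) w /\ inl b <> w).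
    by move=> U; have [b] := set_valP U; exists b.
  apply: (@Defs.inj_card_le _ _ _ _ (fun U => inl (h U))) => [U V _ _ [e]|U _].
    by apply: val_inj; change (set_val U = set_val V); rewrite -(hP U).1 -(hP V).1 e.
  exact: (hP U).2.
have [Afin|Ainf] := pselect (finite_set [set: A]).
  apply: unc; have /card_leTP[h hinj] := BA.
  have /card_leTP[i iinj] := finite_set_countable Afin.
  apply/card_leTP; exists (fun u => match u with
    | inl b => pickle (inl (map i (h b)) : seq nat + nat)
    | inr n => pickle (inr n : seq nat + nat) end).
  move=> [b|m] [c|n] /(pcan_inj pickleK) //= [].
    by move=> /(inj_map iinj)/hinj ->.
  by move=> ->.
apply: (initial_orderP (weight X)).2 (w) _.
apply: card_le_trans Aseg; apply: card_le_trans (card_le_sum_nat Ainf).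
have /card_leTP[h hinj] := card_le_trans BA (card_le_seq Ainf).
apply/card_leTP; exists (fun u => match u with inl b => inl (h b) | inr n => inr n end).
by move=> [b|m] [c|n] //= [] => [/hinj|] ->.
Qed.

Lemma eval_continuous (I : Type) (X : topologicalType) (i : I) :
  continuous (fun F : {ptws I -> X} => F i).
Proof. exact: (@proj_continuous {classic I} (fun=> X) i). Qed.

Lemma diagonal_continuous (I : Type) (X : topologicalType) :
  continuous (fun z : X => (fun=> z) : {ptws I -> X}).
Proof.
move=> z; apply/cvg_sup => i A; rewrite nbhsE => -[_ [[V Vop <-] Vz] VA].
by apply: filterS (VA) _; exact: open_nbhs_nbhs.
Qed.

Lemma compact_hausdorff_gap (R : realType) (X : topologicalType) (x y : X) :
  compact [set: X] -> hausdorff_space X -> x <> y ->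
  exists f : X -> R, continuous f /\ (f y + 1 < f x)%R.
Proof.
move=> Xco Xhd nxy.
have xy0 : [set y] `&` [set x] = set0.
  by rewrite predeqE => z; split=> // -[-> /= /esym].
have cl1 (z : X) : closed [set z].
  exact/accessible_closed_set1/hausdorff_accessible.
have sep := normal_uniform_separator (compact_normal Xhd Xco) (cl1 y) (cl1 x) xy0.
pose u : X -> R := Urysohn [set y] [set x].
(* [u] is between 0 and 1, so it is doubled to get a gap larger than 1 *)
exists (fun z => u z + u z)%R; split.
  by move=> z; apply: continuousD; exact: Urysohn_continuous.
have -> : u y = 0%R by apply: (Urysohn_sub0 sep); exists y.
have -> : u x = 1%R by apply: (Urysohn_sub1 sep); exists x.
by lra.
Qed.

(** A common point of a subfamily of the open sets built from the pairs
    [x_(g k)], [y_(g k)] restricts to a continuous function on the diagonal of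
    the power, that is on [X].  The finitely many base members that it needs
    have indices below some [w], so that [g] is at most [w] on the subfamily. *)
Lemma not_caliber_Cp (R : realType) (X : topologicalType) (L K : Type)
    (g : K -> weight X) :
  compact [set: X] -> hausdorff_space X -> ~ ([set: weight X] #<= [set: nat]) ->
  inhabited L ->
  (forall w, ~ ([set: K] #<= [set k | initial_order (g k) w])) ->
  ~ caliber (Cp R {ptws L -> X}) K.
Proof.
move=> Xco Xhd unc [l0] gub [_ cal].
set B := min_card (@basis X).
have Bb : basis B := (min_card_basisP X).1.
have wo := initial_order_wo (weight X).
have /choice[x /choice[y xyP]] := fun k => weight_segment_not_separating (g k) Xco unc.
pose cst (z : X) : {ptws L -> X} := fun=> z.
pose Z := Cp R {ptws L -> X}.
pose ev (p : {ptws L -> X}) (F : Z) : R := (set_val F : {ptws {ptws L -> X} -> R}) p.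
have evcont p : continuous (ev p).
  move=> F; apply: (@continuous_comp _ _ _ set_val (fun G : {ptws {ptws L -> X} -> R} => G p)).
    exact: initial_continuous.
  exact: eval_continuous.
pose U k := [set F : Z | (ev (cst (y k)) F + 1 < ev (cst (x k)) F)%R].
have [//||J [JK [F FJ]]] := cal K U.
  move=> k; split.
    have -> : U k = (fun F => ev (cst (x k)) F - ev (cst (y k)) F)%R @^-1`
        [set r | (1 < r)%R].
      by apply/seteqP; split=> F /=; rewrite /U /= ltrBrDl addrC.
    apply: open_comp (@open_gt _ 1%R) => F _.
    by apply: continuousB; exact: evcont.
  have [f [fcont fgap]] := compact_hausdorff_gap R Xco Xhd (xyP k).1.
  have fl0 : continuous ((fun p => f (p l0)) : {ptws L -> X} -> R).
    move=> p; apply: (@continuous_comp _ _ _ (fun p : {ptws L -> X} => p l0) f).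
      exact: eval_continuous.
    exact: fcont.
  by exists (SigSub (mem_set fl0)).
have Fcont : continuous (fun z => ev (cst z) F).
  move=> z; apply: (@continuous_comp _ _ _ cst (set_val F)).
    exact: diagonal_continuous.
  exact: set_valP F (cst z).
have [s [sB sP]] := finite_oscillation_cover Xco Bb Fcont.
have [U' /sB BU'|w wP] := @wo_finite_bound _ _ wo _
    (fun (V : set X) (u : weight X) => exists b : B, set_val b = V /\ u = inl b)
    (inr 0%N) s.
  by exists (inl (SigSub (mem_set BU'))), (SigSub (mem_set BU')).
apply: (gub w); have := JK; rewrite card_eq_sym card_eq_le => /andP[KJ _].
apply: card_le_trans KJ _; apply: subset_card_le => k Jk /=.
apply/(wo_not_lt wo) => wg; case: (xyP k) => _; apply.
have [V [V' [Vs V's Vx V'y VV']]] := sP _ _ (FJ k Jk).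
have sA W : W \in s -> exists b : B, set_val b = W /\
   (initial_order (inl b : weight X) (g k) /\ inl b <> g k).
  move=> /wP[_ [b [<- ->]] bw]; exists b; split=> //.
  exact: wo_le_lt bw wg.
by exists V, V'; split=> //; exact: sA.
Qed.

Theorem proposition7p7 (R : realType) (X : topologicalType) (L : Type)
    (X_nontrivial : exists x y : X, x <> y)
    (X_compact : compact [set: X])
    (X_hausdorff : hausdorff_space X)
    (L_infinite : infinite_card L)
    (L_lt_cf : card_lt L (cf (weight X))) :
  forall K : Type,
    [set: K] #= [set: weight X] \/ [set: K] #= [set: cf (weight X)] ->
    (infinite_card K /\ card_lt L (cf K)) /\
    ~ caliber (Cp R {ptws L -> X}) K.
Proof.
move=> K Kcard; set W := weight X in L_lt_cf Kcard *.
have [LC nCL] := L_lt_cf.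
have natL : [set: nat] #<= [set: L] by exact/infiniteP.
have Cinf : infinite_set [set: cf W].
  by apply/infiniteP; exact: card_le_trans natL LC.
have Winf : infinite_set [set: W].
  by apply/infiniteP; have /infiniteP H := Cinf; exact: card_le_trans H (cf_le_self _).
have Wunc : ~ ([set: W] #<= [set: nat]).
  by move=> Wnat; apply: nCL; apply: card_le_trans (cf_le_self _) (card_le_trans Wnat natL).
have wo := initial_order_wo W.
have WK : [set: cf W] #<= [set: cf K].
  case: Kcard => [KW|KC]; first by apply: cf_card_eq.
  apply: card_le_trans (cf_cf Cinf) _; exact: cf_card_eq.
have CK : [set: cf W] #<= [set: K] := card_le_trans WK (cf_le_self K).
split; [split|].
- by apply/infiniteP; have /infiniteP H := Cinf; exact: card_le_trans H CK.
- split; first exact: card_le_trans LC WK.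
  by move=> KL; apply: nCL; exact: card_le_trans WK KL.
have Linh : inhabited L.
  by have /card_leTP[e _] := natL; exact: (inhabits (e 0%N)).
case: Kcard; rewrite card_eq_le => /andP[/card_leTP[h hinj] leK].
  apply: (@not_caliber_Cp R X L K h) => // w small.
  apply: (infinite_not_le_segment (x := w) Winf).
  apply: card_le_trans leK (card_le_trans small _).
  by apply: (@Defs.inj_card_le _ _ _ _ h) => // ? ? _ _ /hinj.
have [g gP] := cf_strict_bounds Cinf.
apply: (@not_caliber_Cp R X L K (g \o h)) => // w small.
have [c Cc wc] := (cfP W).1 w; pose c' : cf W := SigSub (mem_set Cc).
apply: (infinite_not_le_segment (x := c') Cinf).
apply: card_le_trans leK (card_le_trans small _).
apply: (@Defs.inj_card_le _ _ _ _ h) => [? ? _ _ /hinj//|k /= gkw].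
have [//|c'k] := wo_total (initial_order_wo (cf W)) (h k) c'.
case: ((wo_not_lt wo _ _).2 gkw).
exact: (wo_le_lt wo wc (gP _ _ c'k)).
Qed.
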